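(* Let $\xi$ be a pseudotopology on a set $X$. Then for every $x\in X$, $$\mathbb{U}_{\mathrm{P}_1\xi}(x)=\bigcup_{F\in\mathcal{K}_{\sigma}(\mathbb{U}_{\xi}(x))}\mathrm{cl}_{\beta}F\qquad\text{and}\qquad \mathbb{U}_{\mathrm{P}_1^{\mathbb{U}}\xi}(x)=\mathrm{cl}_{t}\,\mathbb{U}_{\xi}(x).$$ In particular, $\xi$ has countable depth if and only if for every $x\in X$, $\mathrm{cl}_\beta F\subset\mathbb{U}_\xi(x)$ whenever $F$ is a $\sigma$-compact subset of $\mathbb{U}_\xi(x)$.
   Context: Filters on $X$ are families of nonempty subsets closed under finite intersections and supersets, ordered by inclusion ($\leq$); $\bigwedge$ is intersection. A convergence $\xi$ on $X$ is a relation between points and filters, written $x\in\lim_\xi\mathcal{F}$, such that $x\in\lim_\xi\{x\}^{\uparrow}$ for all $x$ (where $\{x\}^\uparrow$ is the principal ultrafilter of $x$), and $\mathcal{F}\subset\mathcal{G}$ implies $\lim_\xi\mathcal{F}\subset\lim_\xi\mathcal{G}$. $\xi$ is a pseudotopology if $\lim_\xi\mathcal{F}=\bigcap\{\lim_\xi\mathcal{U}:\mathcal{U}\supset\mathcal{F}\text{ an ultrafilter}\}$ for every filter $\mathcal{F}$. $\xi$ has countable depth if $\lim_\xi\bigwedge_{\mathcal{F}\in\mathbb{A}}\mathcal{F}=\bigcap_{\mathcal{F}\in\mathbb{A}}\lim_\xi\mathcal{F}$ for every nonempty countable set $\mathbb{A}$ of filters on $X$. $\mathrm{P}_1\xi$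 (resp. $\mathrm{P}_1^{\mathbb{U}}\xi$) is the convergence given by: $x$ is in the limit of $\mathcal{F}$ iff there is a countable set $\mathbb{D}$ of filters (resp. of ultrafilters) on $X$, each converging to $x$ for $\xi$, with $\mathcal{F}\geq\bigwedge_{\mathcal{D}\in\mathbb{D}}\mathcal{D}$. $\mathbb{U}X$ is the set of all ultrafilters on $X$ with the Stone topology $\beta$, having as base the sets $\{\mathcal{U}\in\mathbb{U}X:A\in\mathcal{U}\}$, $A\subset X$; $\mathrm{cl}_\beta$ is its closure. For a convergence $\theta$ on $X$, $\mathbb{U}_\theta(x)=\{\mathcal{U}\in\mathbb{U}X:x\in\lim_\theta\mathcal{U}\}$. $\mathcal{K}_\sigma(A)$ is the set of $\sigma$-compact subsets of $A\subset\mathbb{U}X$. For $A\subset\mathbb{U}X$, $\mathrm{cl}_tA=\bigcup\{\mathrm{cl}_\beta C:C\subset A,\ C\text{ countable}\}$. *)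

(* Defs.v *)
From HB Require Import structures.
From mathcomp Require Import all_boot all_order.
From mathcomp Require Import boolp classical_sets functions cardinality filter.
From mathcomp Require Import topology.

Set Implicit Arguments.
Unset Strict Implicit.
Unset Printing Implicit Defensive.

Local Open Scope classical_set_scope.

(* Filters are proper throughout: the type of filters on X
   is [pfilter_on X].  The order F <= G is [pfilter F `<=` pfilter G]. *)

Definition principal_pfilter (X : Type) (x : X) : pfilter_on X :=
  PFilterPack (principal_filter x) (principal_filter_proper x).

Lemma pfilter_meet_proper (X : Type) (A : set (pfilter_on X)) :
  A !=set0 -> ProperFilter (\bigcap_(F in A) pfilter F).
Proof.
move=> [F0 AF0]; split; first by move=> /(_ F0 AF0); exact: filter_not_empty.
split.
- by move=> F _; exact: (@filterT _ _ (pfilter_class F)).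
- by move=> P Q AP AQ F AF; apply: filterI; [exact: AP|exact: AQ].
- by move=> P Q PQ AP F AF; apply: filterS PQ _; exact: AP.
Qed.

Definition pfilter_meet (X : Type) (A : set (pfilter_on X)) (A0 : A !=set0) :
  pfilter_on X := PFilterPack _ (pfilter_meet_proper A0).

Record ultrafilter (X : Type) := Ultrafilter {
  ultra_pfilter :> pfilter_on X;
  ultra_pfilterP : UltraFilter (pfilter ultra_pfilter)
}.

HB.instance Definition _ (X : Type) := gen_eqMixin (ultrafilter X).
HB.instance Definition _ (X : Type) := gen_choiceMixin (ultrafilter X).

Definition stone_base (X : Type) (A : set X) : set (ultrafilter X) :=
  [set U | pfilter U A].

Lemma stone_base_cover (X : Type) :
  \bigcup_(A in [set: set X]) stone_base A = [set: ultrafilter X].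
Proof.
apply/seteqP; split=> // U _; exists setT => //.
exact: (@filterT _ _ (pfilter_class U)).
Qed.

Lemma stone_base_join (X : Type) (A B : set X) (U : ultrafilter X) :
  [set: set X] A -> [set: set X] B -> stone_base A U -> stone_base B U ->
  exists C : set X, [/\ [set: set X] C, stone_base C U &
    stone_base C `<=` stone_base A `&` stone_base B].
Proof.
move=> _ _ UA UB; exists (A `&` B); split=> //; first exact: filterI.
move=> V VAB; split; apply: filterS VAB => x [] //.
Qed.

HB.instance Definition _ (X : Type) := isBaseTopological.Build (ultrafilter X)
  (@stone_base_cover X) (@stone_base_join X).

Record convergence (X : Type) := Convergence {
  clim : pfilter_on X -> set X;
  clim_principal : forall x : X, clim (principal_pfilter x) x;
  clim_mono : forall F G : pfilter_on X,
    pfilter F `<=` pfilter G -> clim F `<=` clim G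
}.

Definition pseudotopology (X : Type) (xi : convergence X) : Prop :=
  forall F : pfilter_on X,
    clim xi F =
    \bigcap_(U in [set U : ultrafilter X | pfilter F `<=` pfilter U]) clim xi U.

Definition countable_depth (X : Type) (xi : convergence X) : Prop :=
  forall (A : set (pfilter_on X)) (A0 : A !=set0), countable A ->
    clim xi (pfilter_meet A0) = \bigcap_(F in A) clim xi F.

(* When D is empty the intersection below is the powerset of X, which no proper
   filter contains; hence empty families contribute no limits. *)
Definition P1_lim (X : Type) (xi : convergence X) (F : pfilter_on X) : set X :=
  [set x | exists D : set (pfilter_on X),
    [/\ countable D, forall G, D G -> clim xi G x &
        \bigcap_(G in D) pfilter G `<=` pfilter F]].

Definition P1U_lim (X : Type) (xi : convergence X) (F : pfilter_on X) : set X :=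
  [set x | exists D : set (ultrafilter X),
    [/\ countable D, forall U, D U -> clim xi U x &
        \bigcap_(U in D) pfilter U `<=` pfilter F]].

Lemma P1_lim_principal (X : Type) (xi : convergence X) (x : X) :
  P1_lim xi (principal_pfilter x) x.
Proof.
exists [set principal_pfilter x]; split; first exact: countable1.
- by move=> _ ->; exact: clim_principal.
- by rewrite bigcap_set1.
Qed.

Lemma P1_lim_mono (X : Type) (xi : convergence X) (F G : pfilter_on X) :
  pfilter F `<=` pfilter G -> P1_lim xi F `<=` P1_lim xi G.
Proof.
by move=> FG x [D [cD Dx DF]]; exists D; split=> //; exact: subset_trans FG.
Qed.

Lemma P1U_lim_principal (X : Type) (xi : convergence X) (x : X) :
  P1U_lim xi (principal_pfilter x) x.
Proof.
exists [set @Ultrafilter _ (principal_pfilter x) (principal_filter_ultra x)].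
split; first exact: countable1.
- by move=> _ ->; exact: clim_principal.
- by rewrite bigcap_set1.
Qed.

Lemma P1U_lim_mono (X : Type) (xi : convergence X) (F G : pfilter_on X) :
  pfilter F `<=` pfilter G -> P1U_lim xi F `<=` P1U_lim xi G.
Proof.
by move=> FG x [D [cD Dx DF]]; exists D; split=> //; exact: subset_trans FG.
Qed.

Definition P1 (X : Type) (xi : convergence X) : convergence X :=
  Convergence (@P1_lim_principal X xi) (@P1_lim_mono X xi).

Definition P1U (X : Type) (xi : convergence X) : convergence X :=
  Convergence (@P1U_lim_principal X xi) (@P1U_lim_mono X xi).

Definition ultralim (X : Type) (theta : convergence X) (x : X) :
  set (ultrafilter X) := [set U | clim theta U x].

Definition sigma_compact (T : topologicalType) (F : set T) : Prop :=
  exists K : nat -> set T, (forall n, compact (K n)) /\ F = \bigcup_n K n.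

Definition Ksigma (T : topologicalType) (A : set T) : set (set T) :=
  [set F | F `<=` A /\ sigma_compact F].

Definition cl_t (T : topologicalType) (A : set T) : set T :=
  \bigcup_(C in [set C : set T | C `<=` A /\ countable C]) closure C.

(* Main.v *)
(* An ultrafilter U lies in the Stone closure of a set S of ultrafilters iff it
   contains the filter \bigcap_(V in S) V.  Hence a filter G corresponds to the
   compact set of ultrafilters finer than G, and a compact set K, being closed,
   is the set of ultrafilters finer than \bigcap_(V in K) V; for a
   pseudotopology, this filter converges to x as soon as all members of K do.
   Countable families of filters thus correspond to sigma-compact sets of
   ultrafilters, and meets of filters to closures of unions. *)
Require Import Defs.
From mathcomp Require Import all_boot all_order.
From mathcomp Require Import boolp classical_sets functions cardinality filter.
From mathcomp Require Import topology.

Local Open Scope classical_set_scope.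

Lemma open_stone_base {X : Type} (A : set X) :
  open (stone_base A : set (ultrafilter X)).
Proof. by exists [set A] => //; rewrite bigcup_set1. Qed.

Lemma nbhs_stoneP {X : Type} (U : ultrafilter X) (S : set (ultrafilter X)) :
  nbhs U S <-> exists2 A, pfilter U A & stone_base A `<=` S.
Proof.
rewrite nbhsE; split=> [[_ [[D _ <-] [A DA UA]] DS]|[A UA AS]].
  by exists A => //; apply: subset_trans DS => V VA; exists A.
by exists (stone_base A) => //; split=> //; exact: open_stone_base.
Qed.

Lemma ultrafilter_inj {X : Type} (U V : ultrafilter X) :
  pfilter U = pfilter V -> U = V.
Proof.
case: U V => [[U PU] UU] [[V PV] UV] /= E; subst V.
by rewrite (Prop_irrelevance PV PU) in UV *; rewrite (Prop_irrelevance UU UV).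
Qed.

Lemma ultrafilter_sub {X : Type} (U V : ultrafilter X) :
  pfilter U `<=` pfilter V -> U = V.
Proof.
move=> UV; apply: ultrafilter_inj; symmetry.
exact: (@max_filter _ _ (ultra_pfilterP U) _ (pfilter_class V)).
Qed.

Lemma ultrafilterC {X : Type} (U : ultrafilter X) (A : set X) :
  ~ pfilter U A -> pfilter U (~` A).
Proof. by case: (in_ultra_setVsetC A (ultra_pfilterP U)). Qed.

Lemma ultrafilter_disj {X : Type} (U : ultrafilter X) (A : set X) :
  pfilter U A -> ~ pfilter U (~` A).
Proof.
move=> UA UcA; apply: (@filter_not_empty _ _ (pfilter_class U)).
by rewrite -(setICr A); exact: filterI.
Qed.

Lemma ultrafilter_ge {X : Type} (F : pfilter_on X) :
  exists U : ultrafilter X, pfilter F `<=` pfilter U.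
Proof.
have [G [GU FG]] := ultraFilterLemma (pfilter_class F).
by exists (@Ultrafilter X (PFilterPack G ultra_proper) GU).
Qed.

Lemma closure_stoneP {X : Type} (S : set (ultrafilter X)) (U : ultrafilter X) :
  closure S U <-> \bigcap_(V in S) pfilter V `<=` pfilter U.
Proof.
split=> [SU A SA|SU B /nbhs_stoneP[A UA AB]].
  apply: contrapT => /ultrafilterC UcA.
  have /SU[V [SV VcA]] : nbhs U (stone_base (~` A)).
    by apply/nbhs_stoneP; exists (~` A).
  exact: ultrafilter_disj (SA V SV) VcA.
(* If [B] missed [S], every [V] in [S] would contain the complement of [A], and hence so would
   [U]. *)
apply: contrapT => SB0; apply: (ultrafilter_disj U A UA); apply: SU => V SV.
by apply: ultrafilterC => VA; apply: SB0; exists V; split=> //; exact: AB.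
Qed.

(** Needed so that compact sets of ultrafilters are closed. *)
Lemma hausdorff_stone {X : Type} : hausdorff_space (ultrafilter X).
Proof.
move=> U V UV; apply: ultrafilter_sub => A UA.
apply: contrapT => /ultrafilterC VcA.
have nU : nbhs U (stone_base A) by apply/nbhs_stoneP; exists A.
have nV : nbhs V (stone_base (~` A)) by apply/nbhs_stoneP; exists (~` A).
by have [W [WA /(ultrafilter_disj W A WA)]] := UV _ _ nU nV.
Qed.

Definition finer_ultra {X : Type} (G : pfilter_on X) : set (ultrafilter X) :=
  [set U | pfilter G `<=` pfilter U].

(** An ultrafilter [FF] on the Stone space that contains [finer_ultra G] converges to its Kowalsky
    sum [W], and [W] refines [G]. *)
Lemma compact_finer_ultra {X : Type} (G : pfilter_on X) :
  compact (finer_ultra G).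
Proof.
rewrite compact_ultra => FF FFU FFG; have FFP : ProperFilter FF := ultra_proper.
pose W : set_system X := [set A | FF (stone_base A)].
have WF : ProperFilter W.
  apply: Build_ProperFilter_ex => [A FA|].
    have [U UA] := @filter_ex _ FF _ _ FA.
    exact: (@filter_ex _ _ (pfilter_class U) _ UA).
  apply: Build_Filter => [|A B FA FB|A B AB FA]; rewrite /W /=.
  - suff -> : stone_base setT = [set: ultrafilter X] by exact: filterT.
    by apply/seteqP; split=> // U _; exact: (@filterT _ _ (pfilter_class U)).
  - apply: (@filterS _ FF _ _ _ _ (@filterI _ FF _ _ _ FA FB)) => U [UA UB].
    exact: (@filterI _ _ (pfilter_class U)).
  - apply: (@filterS _ FF _ _ _ _ FA) => U UA.
    exact: (@filterS _ _ (pfilter_class U) _ _ AB).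
have WU : UltraFilter W.
  (* Were [A] in [H] but not in [W], its complement would lie in [W], hence in [H]. *)
  split=> // H PH WH; apply/seteqP; split=> // A HA.
  have [//|FcA] := in_ultra_setVsetC (stone_base A) FFU.
  have /WH HcA : W (~` A) by apply: filterS FcA => U; exact: ultrafilterC.
  by case: (@filter_not_empty _ H PH); rewrite -(setICr A); exact: filterI.
exists (@Ultrafilter X (PFilterPack W WF) WU); split.
  by move=> A GA; apply: filterS FFG => U; exact.
by move=> S /nbhs_stoneP[A WA AS]; apply: filterS AS _.
Qed.

(** If [A] is not in [G], removing [A] from the members of [G] generates a proper filter; an
    ultrafilter above it refines [G] but omits [A]. *)
Lemma bigcap_finer_ultra {X : Type} (G : pfilter_on X) :
  \bigcap_(U in finer_ultra G) pfilter U `<=` pfilter G.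
Proof.
move=> A GA; apply: contrapT => nGA.
have PF : ProperFilter (filter_from (pfilter G) (fun B => B `\` A)).
  apply: filter_from_proper.
    apply: filter_from_filter; first by exists setT; exact: filterT.
    move=> B C GB GC; exists (B `&` C); first exact: filterI.
    by move=> y [[By Cy] nAy].
  move=> B GB; apply: contrapT => BA0; apply: nGA.
  apply: filterS GB => y By; apply: contrapT => nAy.
  by apply: BA0; exists y.
have [U FU] := ultrafilter_ge (PFilterPack _ PF).
apply: (ultrafilter_disj U A).
  by apply: GA => B GB; apply: FU; exists B => // y [].
by apply: FU; exists setT; [exact: filterT|move=> y []].
Qed.

Lemma compact_ultralim_meet {X : Type} {xi : convergence X} {x : X}
    {K : set (ultrafilter X)} :
  pseudotopology xi -> compact K -> K `<=` ultralim xi x ->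
  exists2 G : pfilter_on X,
    clim xi G x & forall V, K V -> pfilter G `<=` pfilter V.
Proof.
move=> hxi cK Kx; have [->|/set0P K0] := eqVneq K set0.
  (* The empty set has no proper meet; any filter converging to [x] serves. *)
  by exists (principal_pfilter x) => //; exact: clim_principal.
pose A := [set ultra_pfilter V | V in K].
have A0 : A !=set0 by exact: image_nonempty.
exists (pfilter_meet A0); last by move=> V KV B; apply; exists V.
(* An ultrafilter finer than the meet lies in the closure of [K], that is, in [K]. *)
rewrite hxi => U AU; apply: Kx.
have /closure_id -> := compact_closed hausdorff_stone cK.
by apply/closure_stoneP => B KB; apply: AU => _ [V KV <-]; exact: KB.
Qed.

Lemma ultralim_P1 {X : Type} {xi : convergence X} (x : X) :
  pseudotopology xi ->
  ultralim (P1 xi) x = \bigcup_(F in Ksigma (ultralim xi x)) closure F.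
Proof.
move=> hxi; apply/seteqP; split=> U.
  move=> [D [cD Dx DU]].
  (* An empty [D] would put the empty set in [U]; otherwise a sequence [G] enumerates [D]. *)
  have [D0|/surjfunPex[G DG]] := pfcard_geP cD.
    exfalso; apply: (@filter_not_empty _ _ (pfilter_class U)).
    by apply: DU; rewrite D0 bigcap_set0.
  exists (\bigcup_n finer_ultra (G n)); last first.
    apply/closure_stoneP => A GA; apply: DU; rewrite DG => _ [n _ <-].
    by apply: bigcap_finer_ultra => V GV; apply: GA; exists n.
  split; last first.
    by exists (finer_ultra \o G); split=> // n; exact: compact_finer_ultra.
  move=> V [n _ GV]; apply: (clim_mono GV); apply: Dx.
  by rewrite DG; exists n.
move=> [F [Fx [K [cK FK]]] /closure_stoneP]; rewrite {}FK in Fx *; move=> KU.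
have Kx n : K n `<=` ultralim xi x by move=> V KV; apply: Fx; exists n.
(* One convergent filter is chosen below each compact piece [K n]; these filters form the countable
   family. *)
have /choice[G GP] n : exists G : pfilter_on X,
    clim xi G x /\ forall V, K n V -> pfilter G `<=` pfilter V.
  by have [G] := compact_ultralim_meet hxi (cK n) (Kx n); exists G.
exists (range G); split.
- exact: card_image_le.
- by move=> _ [n _ <-]; exact: (GP n).1.
- move=> A GA; apply: KU => V [n _ KV].
  by apply: ((GP n).2 V KV); apply: GA; exists n.
Qed.

(** The same countable set of ultrafilters witnesses both sides. *)
Lemma ultralim_P1U {X : Type} (xi : convergence X) (x : X) :
  ultralim (P1U xi) x = cl_t (ultralim xi x).
Proof.
apply/seteqP; split=> U.
  by move=> [D [cD Dx DU]]; exists D => //; exact/closure_stoneP.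
by move=> [D [Dx cD] /closure_stoneP DU]; exists D.
Qed.

Theorem proposition36 (X : Type) (xi : convergence X)
    (hxi : pseudotopology xi) :
  (forall x : X,
     ultralim (P1 xi) x = \bigcup_(F in Ksigma (ultralim xi x)) closure F /\
     ultralim (P1U xi) x = cl_t (ultralim xi x)) /\
  (countable_depth xi <->
   forall (x : X) (F : set (ultrafilter X)),
     F `<=` ultralim xi x -> sigma_compact F -> closure F `<=` ultralim xi x).
Proof.
split=> [x|].
  by split; [exact: ultralim_P1|exact: ultralim_P1U].
split=> [cd x F Fx scF U FU|clF A A0 cA].
  (* The closure point [U] refines the meet of a countable family converging to [x]; countable depth
     makes that meet converge. *)
  have [D [cD Dx DU]] : ultralim (P1 xi) x U.
    by rewrite ultralim_P1 //; exists F.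
  have D0 : D !=set0.
    apply/set0P/eqP => D0; apply: (@filter_not_empty _ _ (pfilter_class U)).
    by apply: DU; rewrite D0 bigcap_set0.
  by apply: (clim_mono (F := pfilter_meet D0)) => //; rewrite cd.
apply/seteqP; split=> x.
  move=> Ax F AF; apply: clim_mono Ax => B; exact.
(* It suffices to treat ultrafilters [U] above the meet, and [A] itself witnesses that [U] converges
   to [x] for [P1 xi]. *)
move=> Ax; rewrite hxi => U AU.
have : ultralim (P1 xi) x U by exists A; split.
by rewrite ultralim_P1 // => -[F [Fx scF]]; exact: clF.
Qed.
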